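(* Let $\mathbb{G}$ be a stratified group with $N$ the dimension of its first stratum, let $\Omega\subset\mathbb{G}$ be a bounded domain, and let $R=\sup_{x\in\Omega}|x'|$. Then for all $1<p<\infty$ and all $f\in C_0^\infty(\Omega\setminus\{x'=0\})$, $$\frac{|N-p|}{Rp}\|f\|_{L^p(\Omega)}\le\|\nabla_Hf\|_{L^p(\Omega)}.$$
   Context: A stratified group (homogeneous Carnot group) is a Lie group $\mathbb{G}=(\mathbb{R}^n,\circ)$ such that: (a) for some natural numbers $N=N_1,N_2,\dots,N_r$ with $N_1+\dots+N_r=n$, writing $\mathbb{R}^n=\mathbb{R}^{N}\times\mathbb{R}^{N_2}\times\dots\times\mathbb{R}^{N_r}$, for every $\lambda>0$ the dilation $\delta_\lambda(x',x^{(2)},\dots,x^{(r)})=(\lambda x',\lambda^2x^{(2)},\dots,\lambda^r x^{(r)})$ is an automorphism of $\mathbb{G}$, where $x'\in\mathbb{R}^N$ and $x^{(k)}\in\mathbb{R}^{N_k}$; (b) if $X_1,\dots,X_N$ are the left-invariant vector fields on $\mathbb{G}$ with $X_k(0)=\partial/\partial x'_k|_0$, then the iterated commutators of $X_1,\dots,X_N$ span the Lie algebra of $\mathbb{G}$ (rank $n$ at every point). $N$ is the dimension of the first stratum. Points are written $x=(x',x'')$ with $x'\in\mathbb{R}^N$ the first-stratum variables, and $|x'|$ is the Euclidean norm on $\mathbb{R}^N$. $\nabla_H=(X_1,\dots,X_N)$ is the horizontal gradient and $|\nabla_H f|=(\sum_k|X_kf|^2)^{1/2}$. $L^p(\Omega)$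 is with respect to Lebesgue measure $dx$ on $\mathbb{R}^n$; the norm of a vector-valued function is that of its Euclidean length. $C_0^\infty(U)$ denotes smooth complex-valued functions with compact support in the open set $U$. *)

(* Defs.v *)
From HB Require Import structures.
From mathcomp Require Import all_boot all_order all_algebra.
From mathcomp Require Import complex.
From mathcomp Require Import all_classical all_reals all_analysis.

Set Implicit Arguments.
Unset Strict Implicit.
Unset Printing Implicit Defensive.

Import Order.TTheory GRing.Theory Num.Theory.
Import numFieldNormedType.Exports.

Local Open Scope classical_set_scope.
Local Open Scope ring_scope.

Definition rV_display : measure_display. Proof. exact. Qed.

Section measurable_rV.
Context {R : realType} {n : nat}.

Definition rV_coord (i : 'I_n) (x : 'rV[R]_n) : R := x ord0 i.

(* The sigma-algebra generated by the n coordinates, i.e. the Borel sets. *)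
Let rV_set0 : g_sigma_preimage rV_coord set0.
Proof. exact: sigma_algebra0. Qed.

Let rV_setC A : g_sigma_preimage rV_coord A -> g_sigma_preimage rV_coord (~` A).
Proof. exact: sigma_algebraC. Qed.

Let rV_bigcup (F : (set 'rV[R]_n)^nat) :
  (forall i, g_sigma_preimage rV_coord (F i)) ->
  g_sigma_preimage rV_coord (\bigcup_i (F i)).
Proof. exact: sigma_algebra_bigcup. Qed.

HB.instance Definition _ := @isMeasurable.Build rV_display
  'rV[R]_n (g_sigma_preimage rV_coord) rV_set0 rV_setC rV_bigcup.

End measurable_rV.

Lemma measurable_rV_coord (R : realType) n (i : 'I_n) :
  measurable_fun [set: 'rV[R]_n] (rV_coord i).
Proof.
move=> _ Y mY; rewrite setTI; apply: sub_sigma_algebra => /=.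
rewrite -bigcup_seq/=; exists i => /=; first by rewrite mem_index_enum.
by exists Y => //; rewrite setTI.
Qed.

Lemma measurable_fun_rV d (T : measurableType d) (R : realType) n
    (f : T -> 'rV[R]_n) :
  (forall i, measurable_fun [set: T] (rV_coord i \o f)) ->
  measurable_fun [set: T] f.
Proof.
move=> mf _ A mA; rewrite setTI; move: A mA.
have sC : sigma_algebra [set: 'rV[R]_n] [set A | measurable (f @^-1` A)].
  split => /=; first by rewrite preimage_set0.
    by move=> A mA; rewrite setTD preimage_setC; exact: measurableC.
  by move=> F mF; rewrite preimage_bigcup; exact: bigcup_measurable.
apply: (smallest_sub sC) => A.
rewrite -bigcup_seq => -[i _ [B mB <-]] /=.
have := mf i measurableT B mB.
by rewrite !setTI comp_preimage.
Qed.

Section lebesgue_rV.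
Context {R : realType}.

Definition rV_cons n (x : R * 'rV[R]_n) : 'rV[R]_n.+1 :=
  \row_i (if unlift ord0 i is Some j then x.2 ord0 j else x.1).

Definition rV_uncons n (x : 'rV[R]_n.+1) : R * 'rV[R]_n :=
  (x ord0 ord0, \row_j x ord0 (lift ord0 j)).

Lemma rV_consK n : cancel (@rV_cons n) (@rV_uncons n).
Proof.
move=> [a x]; rewrite /rV_uncons mxE unlift_none /=; congr pair.
by apply/rowP => j; rewrite !mxE liftK.
Qed.

Lemma measurable_rV_cons n : measurable_fun [set: R * 'rV[R]_n] (@rV_cons n).
Proof.
apply: measurable_fun_rV => i.
rewrite (_ : _ \o _ = fun x : R * 'rV[R]_n =>
    if unlift ord0 i is Some j then rV_coord j x.2 else x.1); last first.
  by apply/funext => x /=; rewrite /rV_coord mxE.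
case: (unlift ord0 i) => [j|]; last exact: measurable_fst.
apply: (@measurableT_comp _ _ _ _ _ _ (rV_coord j)) => //=.
exact: measurable_rV_coord.
Qed.

Lemma measurable_rV_uncons n : measurable_fun [set: 'rV[R]_n.+1] (@rV_uncons n).
Proof.
apply/measurable_fun_pairP; split; first exact: (measurable_rV_coord ord0).
apply: measurable_fun_rV => j.
rewrite (_ : _ \o _ = rV_coord (lift ord0 j)); first exact: measurable_rV_coord.
by apply/funext => x /=; rewrite /rV_coord mxE.
Qed.

Section step.
Variables (n : nat) (m : {sigma_finite_measure set 'rV[R]_n -> \bar R}).

Definition lebesgue_rV_step : set 'rV[R]_n.+1 -> \bar R :=
  pushforward (lebesgue_measure \x m)%E (@rV_cons n).

Let m0 : lebesgue_rV_step set0 = 0%E.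
Proof. by rewrite /lebesgue_rV_step /pushforward preimage_set0 measure0. Qed.

Let m_ge0 A : (0 <= lebesgue_rV_step A)%E.
Proof. by rewrite /lebesgue_rV_step /pushforward. Qed.

Let m_sigma_additive : semi_sigma_additive lebesgue_rV_step.
Proof.
move=> F mF tF mUF; rewrite /lebesgue_rV_step /pushforward preimage_bigcup.
have mcons B : measurable B -> measurable (@rV_cons n @^-1` B).
  by move=> mB; rewrite -[X in measurable X]setTI; exact: measurable_rV_cons.
apply: measure_semi_sigma_additive.
- by move=> k; exact: mcons.
- apply/trivIsetP => /= i j _ _ ij; rewrite -preimage_setI.
  by move/trivIsetP : tF => /(_ _ _ _ _ ij) ->//; rewrite preimage_set0.
- by rewrite -preimage_bigcup; exact: mcons.
Qed.

HB.instance Definition _ := isMeasure.Build _ _ _ lebesgue_rV_step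
  m0 m_ge0 m_sigma_additive.

Let m_sigma_finite : sigma_finite setT lebesgue_rV_step.
Proof.
have /sigma_finiteP[F [TF ndF Foo]] := sigma_finiteT (@lebesgue_measure R).
have /sigma_finiteP[G [TG ndG Goo]] := sigma_finiteT m.
exists (fun k => @rV_uncons n @^-1` (F k `*` G k)).
  rewrite -preimage_bigcup (_ : \bigcup_k _ = setT) ?preimage_setT//.
  apply/seteqP; split => // -[x y] _.
  have : [set: measurableTypeR R] x by []; rewrite TF => -[i _ Fix].
  have : [set: 'rV[R]_n] y by []; rewrite TG => -[j _ Gjy].
  exists (maxn i j) => //; split => /=.
    by move: x Fix; exact/subsetPset/ndF/leq_maxl.
  by move: y Gjy; exact/subsetPset/ndG/leq_maxr.
move=> k; have [mF Fk] := Foo k; have [mG Gk] := Goo k; split.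
  rewrite -[X in measurable X]setTI; apply: measurable_rV_uncons => //.
  exact: measurableX.
rewrite /lebesgue_rV_step /pushforward -comp_preimage.
rewrite (_ : _ \o _ = id); last by apply/funext => x /=; rewrite rV_consK.
by rewrite preimage_id product_measure1E// lte_mul_pinfty// ge0_fin_numE.
Qed.

HB.instance Definition _ := Measure_isSigmaFinite.Build _ _ _ lebesgue_rV_step
  m_sigma_finite.

End step.

Fixpoint lebesgue_rV n : {sigma_finite_measure set 'rV[R]_n -> \bar R} :=
  if n is k.+1 then lebesgue_rV_step (lebesgue_rV k) else
    (\d_(0 : 'rV[R]_0) : {sigma_finite_measure set 'rV[R]_0 -> \bar R}).

Lemma lebesgue_rV_box n (A : 'I_n -> set R) : (forall i, measurable (A i)) ->
  lebesgue_rV n [set x | forall i, A i (x ord0 i)] =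
  (\prod_(i < n) lebesgue_measure (A i))%E.
Proof.
elim: n A => [|n IHn] A mA /=.
  by rewrite big_ord0 diracE mem_set//= => -[].
rewrite big_ord_recl -IHn//.
set B : set 'rV[R]_n := [set x | forall i, A (lift ord0 i) (x ord0 i)].
have mB : measurable B.
  rewrite (_ : B = \bigcap_(i in [set: 'I_n])
      (rV_coord i @^-1` A (lift ord0 i))).
    apply: fin_bigcap_measurable => // i _.
    by rewrite -[X in measurable X]setTI; exact: measurable_rV_coord.
  by apply/seteqP; split => [x Bx i _|x Bx i]; [exact: Bx|exact: (Bx i I)].
rewrite -product_measure1E//.
rewrite /lebesgue_rV_step /pushforward; congr product_measure1.
apply/seteqP; split => -[a x] /= => [Ax|[Aa Ax] i].
  split; first by have := Ax ord0; rewrite mxE unlift_none.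
  by move=> i; have := Ax (lift ord0 i); rewrite mxE liftK.
by rewrite mxE; case: unliftP => [j ->|->].
exact: mA.
Qed.

End lebesgue_rV.

(* C^k maps, through iterated directional derivatives; on a finite-dimensional
   V this is the usual notion. *)
Fixpoint Ck {R : realType} {V W : normedModType R} (k : nat) (f : V -> W)
    : Prop :=
  if k is k'.+1 then
    (forall x, differentiable f x) /\ (forall v, Ck k' ('D_v f))
  else continuous f.

Definition smooth {R : realType} {V W : normedModType R} (f : V -> W) : Prop :=
  forall k, Ck k f.

(* Elements of C_0^oo(U; C), extended by 0 outside U. *)
Definition test_function {R : realType} {V : normedModType R} (U : set V)
    (f : V -> R[i]) : Prop :=
  [/\ smooth (@complex.Re R \o f), smooth (@complex.Im R \o f),
      compact (closure [set x | f x != 0]) &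
      closure [set x | f x != 0] `<=` U].

Record lieGroup {R : realType} (V : normedModType R) := LieGroup {
  lg_mul : V -> V -> V;
  lg_one : V;
  lg_inv : V -> V;
  lg_mulA : associative lg_mul;
  lg_mul1 : left_id lg_one lg_mul;
  lg_mulr1 : right_id lg_one lg_mul;
  lg_mulV : left_inverse lg_one lg_inv lg_mul;
  lg_mulrV : right_inverse lg_one lg_inv lg_mul;
  lg_mul_smooth : smooth (fun xy : V * V => lg_mul xy.1 xy.2);
  lg_inv_smooth : smooth lg_inv }.

Section vector_fields.
Context {R : realType} {V : normedModType R}.

(* A vector field X is given by its coefficients: X x : V is the tangent vector
   at x, so that X acts on functions by (X f)(x) = 'D_(X x) f x. *)
Definition left_invariant (G : lieGroup V) (X : V -> V) : Prop :=
  forall a x, 'd (lg_mul G a) x (X x) = X (lg_mul G a x).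

(* The coefficients of the derivation f |-> X (Y f) - Y (X f). *)
Definition commutator (X Y : V -> V) : V -> V :=
  fun x => 'D_(X x) Y x - 'D_(Y x) X x.

Inductive iterated_commutator (I : Type) (X : I -> V -> V)
    : (V -> V) -> Prop :=
| IterComm0 i : iterated_commutator X (X i)
| IterCommS Y Z : iterated_commutator X Y -> iterated_commutator X Z ->
    iterated_commutator X (commutator Y Z).

Definition lie_derivative (X : V -> V) (f : V -> R[i]) : V -> R[i] := fun x =>
  Complex ('D_(X x) (@complex.Re R \o f) x) ('D_(X x) (@complex.Im R \o f) x).

End vector_fields.

Section stratified.
Context {R : realType} {r : nat} (N : 'I_r.+1 -> nat).

(* R^n = R^(N_1) x ... x R^(N_r); strata are numbered from 0, so the first one
   has index ord0 and stratum i has weight i.+1. *)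
Local Notation n := (\sum_i N i)%N.
Local Notation V := 'rV[R]_n.

Definition dilation (l : R) (x : V) : V :=
  \mxrow_i (l ^+ i.+1 *: submxrow x i).

Definition first_stratum (x : V) : 'rV[R]_(N ord0) := submxrow x ord0.

(* The coordinate vector d/dx'_k, seen in R^n. *)
Definition first_basis (k : 'I_(N ord0)) : V :=
  delta_mx ord0 (tagnat.Rank ord0 k).

(* sg_field k is the left-invariant field X_k, which sg_left_invariant and
   sg_field0 determine uniquely (0 is the identity, being fixed by all
   dilations). *)
Record stratifiedGroup := StratifiedGroup {
  sg_group :> lieGroup V;
  sg_field : 'I_(N ord0) -> V -> V;
  (* dilation l is bijective for 0 < l, hence an automorphism *)
  sg_dilation : forall l, 0 < l ->
    {morph dilation l : x y / lg_mul sg_group x y};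
  sg_left_invariant : forall k, left_invariant sg_group (sg_field k);
  sg_field0 : forall k, sg_field k 0 = first_basis k;
  sg_rank : forall x, exists Y : 'I_n -> V -> V,
    (forall i, iterated_commutator sg_field (Y i)) /\
    \rank (\matrix_i Y i x) = n }.

Definition horizontal_gradient (G : stratifiedGroup) (f : V -> R[i]) (x : V)
    : 'I_(N ord0) -> R[i] :=
  fun k => lie_derivative (sg_field G k) f x.

End stratified.
Arguments stratifiedGroup R {r} N.

Definition euclidean_norm {R : realType} {m : nat} (x : 'rV[R]_m) : R :=
  Num.sqrt (\sum_i x ord0 i ^+ 2).

Definition cabs {R : realType} (z : R[i]) : R := ComplexField.Normc.normc z.

Definition hermitian_norm {R : realType} {m : nat} (z : 'I_m -> R[i]) : R :=
  Num.sqrt (\sum_k cabs (z k) ^+ 2).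

(* Used with g the pointwise (Euclidean) length of a scalar- or vector-valued
   function. *)
Definition Lp_norm {R : realType} {n : nat} (Omega : set 'rV[R]_n) (p : R)
    (g : 'rV[R]_n -> R) : \bar R :=
  'N[lebesgue_rV n]_(p%:E)[(EFin \o g) \_ Omega]%E.

Definition domain {T : topologicalType} (Omega : set T) : Prop :=
  [/\ open Omega, connected Omega & Omega !=set0].

(* Main.v *)
Require Import Defs.
From mathcomp Require Import all_boot all_order all_algebra.
From mathcomp Require Import complex.
From mathcomp Require Import all_classical all_reals all_analysis.
From mathcomp Require Import measurable_realfun.
From mathcomp Require Import ring lra.
Import Order.TTheory GRing.Theory Num.Theory.
Import numFieldNormedType.Exports.
Local Open Scope classical_set_scope.
Local Open Scope ring_scope.
Set Implicit Arguments.
Unset Strict Implicit.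
Unset Printing Implicit Defensive.

(** The inequality is a divergence identity followed by Young's inequality.

Write x' for the first-stratum variables, N for their number and rho = |x'|.
Dilations force two facts about the fields X_k.  The coefficient of X_k along
a coordinate of the stratum with index s (weight s + 1) is homogeneous of
degree s, and it is continuous.  In the first stratum it is therefore
constant, so that X_k x'_i = delta_ik (sg_field_first_stratum).  In general
its derivative along its own coordinate is homogeneous of degree -1 and
continuous at 0, hence zero, so that X_k is divergence-free (sg_field_div0).

Consequently the field with X_k-components |f|^p x'_k rho^(-p) has horizontal
divergence (N - p) |f|^p rho^(-p) + rho^(-p) sum_k x'_k X_k |f|^p, which is a
sum of partial derivatives of compactly supported functions and integrates to
0 (hdivE, integral_hdiv).  It is defined everywhere because f vanishes near
x' = 0, and it is differentiable because |z|^p is C^1 for p > 1, zeros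
included (is_derive_mod_powR, continuous_derive_mod_powR).

By Cauchy-Schwarz the second term is at most p t^(p-1) |grad f| with
t = |f| / rho.  For c = |N - p| / p, Young's inequality turns the identity
into the pointwise bound (c t)^p <= |grad f|^p + kappa * divergence with a
constant kappa (hardy_pointwise).  Integrating kills the divergence, and
rho <= radius on the support of f gives the theorem. *)

(** * Derivatives along lines and coordinates of row vectors *)

Section calculus.
Context {R : realType}.

(** A directional derivative depends only on the restriction of the map to a
line, so that it can be carried to another space along any map that sends the
line to a line. *)
Lemma eq_line_is_derive (V W U : normedModType R)
    (f : V -> U) (g : W -> U) x v y w d :
  (forall t : R, f (t *: v + x) = g (t *: w + y)) ->
  is_derive y w g d -> is_derive x v f d.
Proof.
move=> fg [dg <-].
have fxy : f x = g y by have := fg 0; rewrite !scale0r !add0r.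
have E : (fun h : R => h^-1 *: ((f \o shift x) (h *: v) - f x)) =
         (fun h => h^-1 *: ((g \o shift y) (h *: w) - g y)).
  by apply/funext => h /=; rewrite fg fxy.
by split; rewrite /derivable /derive E.
Qed.

Lemma is_derive_line (V W : normedModType R) (f : V -> W) x v d :
  is_derive x v f d <-> is_derive (0 : R) 1 (fun t : R => f (t *: v + x)) d.
Proof.
split; apply: eq_line_is_derive => t.
  by rewrite addr0 [t *: 1]mulr1.
by rewrite addr0 [t *: 1]mulr1.
Qed.

Lemma is_derive_unique (U W : normedModType R) (f : U -> W) x v d d' :
  is_derive x v f d -> is_derive x v f d' -> d = d'.
Proof. by move=> [_ <-] [_ <-]. Qed.

Lemma is_derive_coord (V : normedModType R) m (M : V -> 'rV[R]_m) x v d j :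
  is_derive x v M d -> is_derive x v (fun y => M y ord0 j) (d ord0 j).
Proof.
move=> [dM <-]; split; first by move/derivable_mxP : dM.
by rewrite derive_mx// mxE.
Qed.

Lemma derive_linear (V : normedModType R) (f : V -> R) x : differentiable f x ->
  forall a u v, 'D_(a *: u + v) f x = a * 'D_u f x + 'D_v f x.
Proof. by move=> df a u v; rewrite !deriveE// linearP. Qed.

Lemma is_derive_comp1 (V : normedModType R) (s : V -> R) (phi : R -> R)
    x v ds dphi :
  is_derive x v s ds -> is_derive (s x) 1 phi dphi ->
  is_derive x v (phi \o s) (dphi * ds).
Proof.
move=> /is_derive_line dsx dp; apply/is_derive_line.
apply: (@is_derive1_comp _ phi (fun t : R => s (t *: v + x)) 0) => //.
by rewrite scale0r add0r.
Qed.

Lemma is_derive_mul (V : normedModType R) (f g : V -> R) x v df dg :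
  is_derive x v f df -> is_derive x v g dg ->
  is_derive x v (fun y => f y * g y) (df * g x + f x * dg).
Proof.
move=> hf hg; apply: (is_derive_eq (is_deriveM hf hg)).
by rewrite addrC -![_ *: _]/(_ * _); congr +%R; rewrite mulrC.
Qed.

Lemma is_derive_bigsum (V : normedModType R) m (f : 'I_m -> V -> R) x v df :
  (forall i, is_derive x v (f i) (df i)) ->
  is_derive x v (fun y => \sum_i f i y) (\sum_i df i).
Proof.
move=> hf; have := is_derive_sum hf.
rewrite (_ : \sum_(i < m) f i = fun y => \sum_i f i y)//.
by apply/funext => y; rewrite fct_sumE.
Qed.

Lemma continuous_bigsum (T : topologicalType) m (f : 'I_m -> T -> R) x :
  (forall i, {for x, continuous (f i)}) ->
  {for x, continuous (fun y => \sum_i f i y)}.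
Proof.
move=> cf; rewrite /prop_for /continuous_at.
elim: (index_enum _) => [|i l IHl].
  by rewrite big_nil; under eq_fun do rewrite big_nil; exact: cvg_cst.
rewrite big_cons; under eq_fun do rewrite big_cons.
by apply: cvgD => //; exact: cf.
Qed.

Lemma norm_coord_le n (x : 'rV[R]_n) i : `|x ord0 i| <= `|x|.
Proof.
rewrite [leRHS]/Num.norm /= mx_normrE; apply/bigmax_geP; right => /=.
by exists (ord0, i).
Qed.

Lemma norm_rV_le n (x : 'rV[R]_n) a :
  0 <= a -> (forall i, `|x ord0 i| <= a) -> `|x| <= a.
Proof.
move=> a0 xa; rewrite [leLHS]/Num.norm /= mx_normrE.
apply/bigmax_leP; split=> //.
by move=> [i j] _ /=; rewrite ord1.
Qed.

Lemma continuous_rV (T : topologicalType) n (F : T -> 'rV[R]_n) :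
  (forall i, continuous (fun t => F t ord0 i)) -> continuous F.
Proof.
move=> cF x; apply/cvgrPdist_le => /= e e0.
have : \forall t \near x, forall i, `|F x ord0 i - F t ord0 i| <= e.
  apply: filter_forall => i.
  by have /cvgrPdist_le /(_ e e0) := cF i x.
apply: filterS => t Ft; apply: norm_rV_le => [|i]; first exact: ltW.
by rewrite !mxE.
Qed.

(** Scalar linearity is stated pointwise, so that it applies to expressions
such as a derivative seen as a function of its direction. *)
Lemma row_linear_sum n (phi : 'rV[R]_n -> R) v :
  (forall a u w, phi (a *: u + w) = a * phi u + phi w) ->
  phi v = \sum_j v ord0 j * phi (delta_mx ord0 j).
Proof.
move=> lphi.
have phi0 : phi 0 = 0.
  by have := lphi (-1) 0 0; rewrite scaler0 add0r mulN1r addNr.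
rewrite {1}(row_sum_delta v); elim/big_rec2 : _ => // j a u _ <-.
by rewrite lphi.
Qed.

End calculus.

(** * Integration over R^n *)

Section integration.
Variable R : realType.

Lemma measurable_rV_ball n (x : 'rV[R]_n) e : 0 < e -> measurable (ball x e).
Proof.
move=> e0.
rewrite (_ : ball x e = \bigcap_(i in [set: 'I_n])
    (rV_coord i @^-1` ball (x ord0 i) e)).
  apply: fin_bigcap_measurable => // i _.
  rewrite -[X in measurable X]setTI; apply: measurable_rV_coord => //.
  by apply: open_measurable; exact: ball_open.
apply/seteqP; split => [y [_ xy] i _|y xy]; first exact: xy.
by split => // i j; rewrite ord1; exact: (xy j I).
Qed.

(** The sigma-algebra on row vectors is generated by the coordinates; it
contains the open sets because these are countable unions of cubes with
rational centres and radii 1/(k+1). *)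
Lemma open_measurable_rV n (U : set 'rV[R]_n) : open U -> measurable U.
Proof.
move=> oU.
pose B (c : 'rV[rat]_n * nat) : set 'rV[R]_n :=
  ball (\row_i ratr (c.1 ord0 i) : 'rV[R]_n) c.2.+1%:R^-1.
pose F k : set 'rV[R]_n := if unpickle k is Some c then
  if `[< B c `<=` U >] then B c else set0 else set0.
rewrite (_ : U = \bigcup_k F k); last first.
  apply/seteqP; split => [x Ux|x [k _]]; last first.
    by rewrite /F; case: unpickle => // c; case: asboolP => // + Bx; exact.
  have [e e0 xeU] : exists2 e, 0 < e & ball x e `<=` U.
    by apply/nbhs_ballP; exact: open_nbhs_nbhs.
  (* a cube of radius below e / 2 that contains x lies in the e-ball of x *)
  have [k _ /(_ k (leqnn k))] : \forall k \near \oo, k.+1%:R^-1 < e / 2 :> R.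
    exact: near_infty_natSinv_lt (PosNum (divr_gt0 e0 (ltr0Sn _ 1))).
  move=> ke.
  have /choice[q xq] : forall i, exists q : rat,
      `|ratr q - x ord0 i| < k.+1%:R^-1.
    move=> i.
    have [|q] := @rat_in_itvoo R (x ord0 i - k.+1%:R^-1)
      (x ord0 i + k.+1%:R^-1).
      by rewrite ltrD2l gt0_cp.
    by rewrite in_itv/= => qx; exists q; rewrite ltr_distl.
  pose c : 'rV[rat]_n * nat := (\row_i q i, k).
  have Bcx : B c x.
    split => // i j; rewrite (ord1 i) !mxE/=; exact: xq.
  exists (pickle c) => //; rewrite /F pickleK; case: asboolP => // -[].
  move=> y [_ By]; apply: xeU; split => // i j.
  have yq : `|ratr (q j) - y ord0 j| < k.+1%:R^-1.
    by have := By ord0 j; rewrite !mxE.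
  rewrite (ord1 i) (splitr e).
  apply: (le_lt_trans (ler_distD (ratr (q j)) _ _)).
  by rewrite ltrD// ?(lt_trans yq)// distrC (lt_trans (xq j)).
apply: bigcup_measurable => k _; rewrite /F; case: unpickle => // c.
by case: asboolP => // _; exact: measurable_rV_ball.
Qed.

Lemma continuous_measurable_rV n (f : 'rV[R]_n -> R) :
  continuous f -> measurable_fun setT f.
Proof.
move=> /continuousP cf; apply: (measurability _ (RGenOpens.measurableE R)).
move=> _ [_ [a [b ->] <-]]; rewrite setTI; apply: open_measurable_rV.
exact/cf/interval_open.
Qed.

Lemma continuous_supported_integrable n (f : 'rV[R]_n -> R) a :
  continuous f -> (forall x, a < `|x| -> f x = 0) ->
  (lebesgue_rV n).-integrable setT (EFin \o f).
Proof.
move=> cf f0.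
pose B : set 'rV[R]_n := [set x | forall i, `[-a, a]%classic (x ord0 i)].
have lt_normB x : ~ B x -> f x = 0.
  move=> nBx; apply: f0; rewrite ltNge; apply: contra_notN nBx => xa i.
  by rewrite /= in_itv/= -ler_norml (le_trans (norm_coord_le _ _)).
have mB : measurable B.
  rewrite (_ : B = \bigcap_(i in [set: 'I_n]) (rV_coord i @^-1` `[-a, a])).
    apply: fin_bigcap_measurable => // i _.
    by rewrite -[X in measurable X]setTI; exact: measurable_rV_coord.
  by apply/seteqP; split => [x Bx i _|x Bx i]; [exact: Bx|exact: (Bx i I)].
have cB : compact B.
  apply: (@rV_compact _ _ (fun=> `[-a, a]%classic)) => i.
  exact: segment_compact.
have mf := continuous_measurable_rV cf.
rewrite (_ : EFin \o f = (EFin \o f) \_ B); last first.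
  apply/funext => x; rewrite patchE; case: ifPn => // /negP.
  by rewrite inE /= => /lt_normB ->.
apply/integrable_restrict => //; rewrite setTI.
apply: measurable_bounded_integrable => //.
- rewrite [X in (X < _)%E](lebesgue_rV_box (A := fun=> `[-a, a]%classic))//.
  rewrite ltey_eq; apply/orP; left.
  elim/big_ind : _ => // [x y xoo yoo|i _]; first exact: fin_numM.
  by rewrite lebesgue_measure_itv/=; case: ifP.
- exact: measurable_funTS.
- have : compact (f @` B).
    by apply: continuous_compact => //; exact: continuous_subspaceT.
  move=> /compact_bounded[M [Mr MB]]; exists M; split=> // y /MB + x Bx.
  by apply; exists x.
Qed.
Lemma continuous_rV_cons_r n (a : R) :
  continuous (fun x : 'rV[R]_n => rV_cons (a, x)).
Proof.
apply: continuous_rV => i.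
rewrite (_ : (fun _ => _) = fun x : 'rV[R]_n =>
    if unlift ord0 i is Some j then x ord0 j else a); last first.
  by apply/funext => x; rewrite mxE.
case: (unlift ord0 i) => [j|] x; first exact: coord_continuous.
exact: cst_continuous.
Qed.

Lemma continuous_rV_cons_l n (x : 'rV[R]_n) :
  continuous (fun a : R => rV_cons (a, x)).
Proof.
apply: continuous_rV => i.
rewrite (_ : (fun _ => _) = fun a : R =>
    if unlift ord0 i is Some j then x ord0 j else a); last first.
  by apply/funext => a; rewrite mxE.
by case: (unlift ord0 i) => [j|] a; [exact: cst_continuous|exact: cvg_id].
Qed.

Lemma norm_rV_cons_l n (x : 'rV[R]_n) a : `|a| <= `|rV_cons (a, x)|.
Proof.
by have := norm_coord_le (rV_cons (a, x)) ord0; rewrite mxE unlift_none/=.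
Qed.

Lemma norm_rV_cons_r n (x : 'rV[R]_n) a : `|x| <= `|rV_cons (a, x)|.
Proof.
apply: norm_rV_le => // i.
by have := norm_coord_le (rV_cons (a, x)) (lift ord0 i); rewrite mxE liftK/=.
Qed.

(** A function that vanishes outside a ball vanishes near each point outside
the closed ball, so its derivatives vanish there too. *)
Lemma is_derive_supported (V : normedModType R) (f : V -> R) a x v d :
  (forall x, a < `|x| -> f x = 0) -> a < `|x| -> is_derive x v f d -> d = 0.
Proof.
move=> f0 ax [_ <-].
rewrite (@near_eq_derive _ _ _ f (cst 0)) ?derive_cst//.
have : \forall y \near x, a < `|y| by apply: cvgr_gt ax; exact: norm_continuous.
by apply: filterS => y /f0.
Qed.

Lemma integral_derive_supported (h g : R -> R) (a : R) :
  continuous g -> (forall x, a < `|x| -> h x = 0) ->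
  (forall x : R, is_derive x 1 h (g x)) ->
  (\int[lebesgue_measure]_x (g x)%:E = 0)%E.
Proof.
move=> cg h0 dh; pose b := `|a| + 1.
have ab : a < b by rewrite /b (le_lt_trans (ler_norm a))// ltrDl.
have b0 : 0 < b by rewrite /b ltr_wpDl.
have ch : continuous h.
  move=> x; apply/differentiable_continuous/derivable1_diffP.
  by have [] := dh x.
rewrite (_ : (fun x => _) = (EFin \o g) \_ `[-b, b]); last first.
  apply/funext => x; rewrite patchE; case: ifPn => //.
  rewrite notin_setE/= in_itv/= -ler_norml => /negP; rewrite -ltNge => bx.
  by rewrite (is_derive_supported h0 (lt_trans ab bx) (dh x)).
rewrite -integral_mkcond (continuous_FTC2 (F := h)) //=.
- rewrite !h0 ?subee//.
    by rewrite normrN gtr0_norm.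
  by rewrite gtr0_norm.
- by rewrite gtrN.
- exact: continuous_subspaceT.
- split => [x _||]; first by have [] := dh x.
    exact/cvg_at_right_filter/ch.
  exact/cvg_at_left_filter/ch.
- by move=> x _; rewrite derive1E; have [_ ->] := dh x.
Qed.

(** The Lebesgue measure lives on measurableTypeR R, whose display is not the
one that R alone receives; product-measure lemmas need this form. *)
Lemma measurable_rV_consR n :
  measurable_fun [set: measurableTypeR R * 'rV[R]_n] (@rV_cons R n).
Proof. exact: measurable_rV_cons. Qed.

Lemma lebesgue_rV_ge0_integralE n (f : 'rV[R]_n.+1 -> \bar R) :
  measurable_fun setT f -> (forall x, 0 <= f x)%E ->
  (\int[lebesgue_rV n.+1]_x f x =
   \int[lebesgue_measure \x lebesgue_rV n]_z f (rV_cons z))%E.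
Proof.
move=> mf f0.
have := ge0_integral_pushforward (@measurable_rV_consR n)
  (lebesgue_measure \x lebesgue_rV n)%E measurableT mf (fun x _ => f0 x).
by rewrite preimage_setT.
Qed.

Lemma lebesgue_rV_integralE n (f : 'rV[R]_n.+1 -> \bar R) :
  measurable_fun setT f ->
  (lebesgue_measure \x lebesgue_rV n)%E.-integrable setT (f \o @rV_cons R n) ->
  (\int[lebesgue_rV n.+1]_x f x =
   \int[lebesgue_measure \x lebesgue_rV n]_z f (rV_cons z))%E.
Proof.
move=> mf f0.
have := integral_pushforward (@measurable_rV_consR n) mf f0 measurableT.
by rewrite preimage_setT.
Qed.

(** The measure is an iterated product, so Fubini lets the inner integral run over the
differentiation variable: it is the fundamental theorem of calculus when that
variable comes first, and the induction hypothesis otherwise. *)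
Lemma integral_partial_derive n (j : 'I_n) (h g : 'rV[R]_n -> R) a :
  continuous g -> (forall x, a < `|x| -> h x = 0) ->
  (forall x, is_derive x (delta_mx ord0 j : 'rV_n) h (g x)) ->
  (\int[lebesgue_rV n]_x (g x)%:E = 0)%E.
Proof.
elim: n j h g => [[]//|n IHn] j h g cg h0 dh.
have g0 x : a < `|x| -> g x = 0.
  by move=> ax; exact: is_derive_supported h0 ax (dh x).
have ig : (lebesgue_rV n.+1).-integrable setT (EFin \o g).
  exact: continuous_supported_integrable g0.
have mcons := @measurable_rV_consR n.
have mg : measurable_fun setT (EFin \o g).
  by apply/measurable_EFinP; exact: continuous_measurable_rV.
have igc : (lebesgue_measure \x lebesgue_rV n)%E.-integrable setT
    ((EFin \o g) \o @rV_cons R n).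
  apply/integrableP; split; first exact: measurableT_comp.
  have /integrableP[_] := ig; apply: le_lt_trans.
  rewrite le_eqVlt; apply/orP; left; apply/eqP/esym.
  by rewrite lebesgue_rV_ge0_integralE//; exact: measurableT_comp.
rewrite (lebesgue_rV_integralE mg)//.
have lineE i t (a0 : R) (x : 'rV[R]_n) :
    rV_cons (a0, t *: delta_mx ord0 i + x) =
    t *: delta_mx ord0 (lift ord0 i) + rV_cons (a0, x).
  apply/rowP => k; rewrite !mxE /=.
  case: unliftP => [l ->|->]; rewrite ?mxE ?eqxx/=.
    by rewrite (inj_eq (@lift_inj _ _)).
  by rewrite mulr0 add0r.
have lineE0 t (a0 : R) (x : 'rV[R]_n) :
   rV_cons (t *: 1 + a0, x) = t *: delta_mx ord0 ord0 + rV_cons (a0, x).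
  apply/rowP => k; rewrite !mxE /=.
  case: unliftP => [l ->|->]; rewrite ?mxE ?eqxx/=.
    by rewrite mulr0 add0r.
  by [].
have [i ij|j0] := unliftP ord0 j; [rewrite ij in dh|rewrite j0 in dh].
  rewrite -integral12_prod_meas1//.
  rewrite integral0_eq// => x _; rewrite /fubini_F /=.
  apply: (IHn i (fun y => h (rV_cons (x, y)))).
  - move=> y; apply: continuous_comp; [exact: continuous_rV_cons_r|exact: cg].
  - by move=> y ay; apply: h0; rewrite (lt_le_trans ay)// norm_rV_cons_r.
  - by move=> y; apply: eq_line_is_derive (dh _) => t; rewrite lineE.
rewrite -integral21_prod_meas1//.
rewrite integral0_eq// => y _; rewrite /fubini_G /=.
apply: (@integral_derive_supported (fun x => h (rV_cons (x, y))) _ a).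
- move=> x; apply: continuous_comp; [exact: continuous_rV_cons_l|exact: cg].
- by move=> x ax; apply: h0; rewrite (lt_le_trans ax)// norm_rV_cons_l.
- by move=> x; apply: eq_line_is_derive (dh _) => t; rewrite lineE0.
Qed.
End integration.

(** * Horizontal left-invariant fields *)

Section fields.
Context {R : realType} {r : nat} {N : 'I_r.+1 -> nat}.
Local Notation n := (\sum_i N i)%N.
Local Notation V := 'rV[R]_n.

(** Strata are indexed from 0, so that the dilation weight of the coordinate j
is (stratum j).+1. *)
Definition stratum (j : 'I_n) : nat := tagnat.sig1 j.

Lemma dilationE l (x : V) j :
  dilation l x ord0 j = l ^+ (stratum j).+1 * x ord0 j.
Proof. by rewrite /dilation !mxE tagnat.sig2K. Qed.

Lemma dilationD l (x y : V) : dilation l (x + y) = dilation l x + dilation l y.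
Proof. by apply/rowP => j; rewrite !(dilationE, mxE) mulrDr. Qed.

Lemma dilationZ l a (x : V) : dilation l (a *: x) = a *: dilation l x.
Proof. by apply/rowP => j; rewrite !(dilationE, mxE) mulrCA. Qed.

Lemma dilation_delta l (j : 'I_n) :
  dilation l (delta_mx ord0 j : V) = l ^+ (stratum j).+1 *: delta_mx ord0 j.
Proof.
apply/rowP => i; rewrite !(dilationE, mxE) eqxx /=.
by have [->//|] := eqVneq i j; rewrite !mulr0.
Qed.

Lemma dilation_cvg0 (T : topologicalType) (f : V -> T) (x : V) :
  {for 0, continuous f} -> f (dilation l x) @[l --> 0^'+] --> f 0.
Proof.
move=> cf.
have cd : continuous (fun l : R => dilation l x).
  apply: continuous_rV => j.
  rewrite (_ : (fun _ => _) = fun l : R => l ^+ (stratum j).+1 * x ord0 j).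
    by move=> l; apply: cvgMl; exact: exprn_continuous.
  by apply/funext => l; rewrite dilationE.
have d0 : dilation 0 x = 0.
  by apply/rowP => j; rewrite dilationE expr0n mul0r mxE.
apply: cvg_at_right_filter; rewrite -d0.
apply: (@continuous_comp _ _ _ (fun l : R => dilation l x) f); first exact: cd.
by rewrite d0.
Qed.

(** Let the dilation parameter tend to 0: every orbit accumulates at 0. *)
Lemma dilation_invariant_cst (f : V -> R) x : {for 0, continuous f} ->
  (forall l, 0 < l -> f (dilation l x) = f x) -> f x = f 0.
Proof.
move=> cf fx.
apply: (@cvg_unique _ (@Rhausdorff R) (f (dilation l x) @[l --> 0^'+])).
  apply: cvg_near_cst; near=> l; apply: fx; near: l; exact: nbhs_right_gt.
exact: dilation_cvg0.
Unshelve. all: by end_near. Qed.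

(** A function of degree -1 that is continuous at 0 is the limit of
l * f (dilation l x) as l tends to 0, which is 0 * f 0. *)
Lemma dilation_degN1_eq0 (f : V -> R) x : {for 0, continuous f} ->
  (forall l, 0 < l -> l * f (dilation l x) = f x) -> f x = 0.
Proof.
move=> cf fx.
apply: (@cvg_unique _ (@Rhausdorff R)
  ((l * f (dilation l x)) @[l --> 0^'+])).
  apply: cvg_near_cst; near=> l; apply: fx; near: l; exact: nbhs_right_gt.
have : (l * f (dilation l x)) @[l --> 0^'+] --> 0 * f 0.
  apply: cvgM; last exact: dilation_cvg0.
  exact/cvg_at_right_filter/cvg_id.
by rewrite mul0r.
Unshelve. all: by end_near. Qed.

Variable G : stratifiedGroup R N.
Local Notation X := (sg_field G).

(** Automorphisms fix the identity, and 0 is the only fixed point of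
dilation 2. *)
Lemma lg_one0 : lg_one G = 0 :> V.
Proof.
set e := lg_one G.
have de : dilation 2 e = e.
  have : lg_mul G (dilation 2 e) (dilation 2 e) = dilation 2 e.
    by rewrite -(sg_dilation G)// lg_mul1.
  move=> /(congr1 (lg_mul G (lg_inv G (dilation 2 e)))).
  by rewrite lg_mulA lg_mulV lg_mul1.
apply/rowP => j; rewrite mxE.
have /rowP/(_ j)/eqP := de.
rewrite dilationE -subr_eq0 -[X in _ - X]mul1r -mulrBl.
rewrite mulf_eq0 => /orP[|/eqP//]; rewrite subr_eq0 => /eqP h.
have : 1 < 2 ^+ (stratum j).+1 :> R by rewrite exprn_egt1// ltr1n.
by rewrite h ltxx.
Qed.

Lemma lg_mulx0 (a : V) : lg_mul G a 0 = a.
Proof. by rewrite -lg_one0 lg_mulr1. Qed.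

Lemma lg_mull_differentiable (a : V) x : differentiable (lg_mul G a) x.
Proof.
have [dmul _] := lg_mul_smooth G 1.
apply: (@differentiable_comp _ _ _ _ (fun y : V => (a, y))
  (fun z : V * V => lg_mul G z.1 z.2)) => //.
Qed.

(** The field is recovered from its value at the identity through left
translations. *)
Lemma sg_field_translation k (a : V) :
  is_derive (0 : V) (first_basis k) (lg_mul G a) (X k a).
Proof.
have da := lg_mull_differentiable a 0.
split; first exact: diff_derivable.
by rewrite deriveE// -(sg_field0 G) (sg_left_invariant G) lg_mulx0.
Qed.

(** This turns the point a, a parameter of the left translation, into a
variable of the smooth map (x, y) |-> x y, from which X k inherits its
regularity. *)
Lemma sg_field_param k (a : V) :
  X k a = 'D_((0, first_basis k) : V * V)
    (fun xy : V * V => lg_mul G xy.1 xy.2) (a, 0).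
Proof.
have [dmul _] := lg_mul_smooth G 1.
have /(@derivableP _ _ _ _ _ _) dm :=
  diff_derivable (v := (0, first_basis k)) (dmul (a, 0)).
apply: is_derive_unique (sg_field_translation k a) _.
apply: eq_line_is_derive dm => t /=.
by rewrite scaler0 add0r addr0.
Qed.

Lemma sg_field_differentiable k x : differentiable (X k) x.
Proof.
have [_ /(_ (0, first_basis k))[dY _]] := lg_mul_smooth G 2.
rewrite (_ : X k = 'D_((0, first_basis k) : V * V)
    (fun xy : V * V => lg_mul G xy.1 xy.2) \o (fun a : V => (a, 0 : V))).
  by apply: differentiable_comp => //; exact: differentiable_pair.
by apply/funext => a /=; exact: sg_field_param.
Qed.

Lemma sg_field_continuous k : continuous (X k).
Proof.
by move=> x; exact/differentiable_continuous/sg_field_differentiable.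
Qed.

Lemma sg_field_coord_continuous k j : continuous (fun x => X k x ord0 j).
Proof.
move=> x; apply: (@continuous_comp _ _ _ (X k) (fun M : V => M ord0 j)).
  exact: sg_field_continuous.
exact: coord_continuous.
Qed.

Lemma sg_field_C1 k v : continuous ('D_v (X k)).
Proof.
have [_ /(_ (0, first_basis k))[dY /(_ (v, 0)) cY]] := lg_mul_smooth G 2.
rewrite (_ : 'D_v (X k) = 'D_((v, 0) : V * V) ('D_((0, first_basis k) : V * V)
    (fun xy : V * V => lg_mul G xy.1 xy.2)) \o (fun a : V => (a, 0 : V))).
  move=> x; apply: continuous_comp; last exact: cY.
  exact/differentiable_continuous/differentiable_pair.
apply/funext => a /=.
have /(@derivableP _ _ _ _ _ _) := diff_derivable (v := (v, 0)) (dY (a, 0)).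
set d := 'D_(v, 0) _ _ => dd.
suff : is_derive a v (X k) d by case.
apply: eq_line_is_derive dd => t.
have -> : t *: ((v, 0) : V * V) + (a, 0) = (t *: v + a, 0).
  by congr pair => /=; rewrite scaler0 addr0.
exact: sg_field_param.
Qed.

(** Differentiate at 0 the identity
mul (dilation l x) (dilation l y) = dilation l (mul x y) in the direction of
first_basis k, which dilation l multiplies by l; the two sides give
l * X k (dilation l x) and dilation l (X k x). *)
Lemma sg_field_dilation k l (x : V) j : 0 < l ->
  X k (dilation l x) ord0 j = l ^+ stratum j * X k x ord0 j.
Proof.
move=> l0; pose e : V := first_basis k.
have ld : dilation l e = l *: e.
  by rewrite dilation_delta /stratum tagnat.Rank1K.
have dl : is_derive (0 : V) (l *: e) (lg_mul G (dilation l x))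
    (l *: X k (dilation l x)).
  have dm := lg_mull_differentiable (dilation l x) 0.
  split; first exact: diff_derivable.
  rewrite deriveE// linearZ/= -deriveE//.
  by have [_ ->] := sg_field_translation k (dilation l x).
have d1 : is_derive (0 : V) e (fun y => dilation l (lg_mul G x y) ord0 j)
    (l * X k (dilation l x) ord0 j).
  have := is_derive_coord j dl; rewrite mxE; apply: eq_line_is_derive => t.
  by rewrite !addr0 (sg_dilation G)// dilationZ ld.
have d2 : is_derive (0 : V) e (fun y => dilation l (lg_mul G x y) ord0 j)
    (l ^+ (stratum j).+1 * X k x ord0 j).
  rewrite (_ : (fun _ => _) =
      l ^+ (stratum j).+1 *: (fun y => lg_mul G x y ord0 j)); last first.
    by apply/funext => y; rewrite dilationE.
  by apply: is_deriveZ; exact/is_derive_coord/sg_field_translation.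
apply: (mulfI (lt0r_neq0 l0)).
by rewrite (is_derive_unique d1 d2) exprS mulrA.
Qed.

(** The coefficients of degree 0 are constant. *)
Lemma sg_field_first_stratum k (x : V) j : stratum j = 0%N ->
  X k x ord0 j = first_basis k ord0 j.
Proof.
move=> j0; rewrite -(sg_field0 G).
apply: (dilation_invariant_cst (f := fun y => X k y ord0 j)).
  exact: sg_field_coord_continuous.
by move=> l l0; rewrite sg_field_dilation// j0 mul1r.
Qed.

(** Each diagonal derivative vanishes, not just their sum: differentiating a
coefficient of degree s along a coordinate of weight s + 1 leaves degree
-1. *)
Lemma sg_field_div0 k (x : V) j :
  is_derive x (delta_mx ord0 j : V) (fun y => X k y ord0 j) 0.
Proof.
set e : V := delta_mx ord0 j.
have dX y v : is_derive y v (fun y => X k y ord0 j) ('D_v (X k) y ord0 j).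
  apply/is_derive_coord/derivableP/diff_derivable.
  exact: sg_field_differentiable.
suff d0 : 'D_e (X k) x ord0 j = 0 by have := dX x e; rewrite d0.
apply: (dilation_degN1_eq0 (f := fun y => 'D_e (X k) y ord0 j)).
  apply: (@continuous_comp _ _ _ ('D_e (X k)) (fun M : V => M ord0 j)).
    exact: sg_field_C1.
  exact: coord_continuous.
move=> l l0.
have d1 : is_derive x e (fun y => X k (dilation l y) ord0 j)
    (l ^+ (stratum j).+1 * 'D_e (X k) (dilation l x) ord0 j).
  have -> : l ^+ (stratum j).+1 * 'D_e (X k) (dilation l x) ord0 j =
      'D_(dilation l e) (X k) (dilation l x) ord0 j.
    have dm := @sg_field_differentiable k (dilation l x).
    by rewrite !deriveE// dilation_delta linearZ/= mxE.
  apply: eq_line_is_derive (dX _ _) => t.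
  by rewrite dilationD dilationZ.
have d2 : is_derive x e (fun y => X k (dilation l y) ord0 j)
    (l ^+ stratum j * 'D_e (X k) x ord0 j).
  rewrite (_ : (fun _ => _) = l ^+ stratum j *: (fun y => X k y ord0 j)).
    by apply: is_deriveZ; exact: dX.
  by apply/funext => y; rewrite sg_field_dilation.
apply: (mulfI (lt0r_neq0 (exprn_gt0 (stratum j) l0))).
by rewrite mulrA -exprSr; exact: is_derive_unique d1 d2.
Qed.
End fields.

(** * Powers of the modulus *)

Section powers.
Context {R : realType}.

Lemma continuous_powR_gt0 (T : topologicalType) (F : T -> R) x r :
  0 < F x -> {for x, continuous F} -> {for x, continuous (fun y => F y `^ r)}.
Proof.
move=> F0 cF; apply: (@continuous_comp _ _ _ F (fun y => y `^ r)) => //.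
apply/differentiable_continuous/derivable1_diffP.
by have [] := is_derive1_powR r F0.
Qed.

(** At a zero of F, F <= e^(1/r) gives F^r <= e; elsewhere the power is
differentiable. *)
Lemma continuous_powR (T : topologicalType) (F : T -> R) x r :
  0 < r -> (forall y, 0 <= F y) ->
  {for x, continuous F} -> {for x, continuous (fun y => F y `^ r)}.
Proof.
move=> r0 F0 cF; have := F0 x; rewrite le_eqVlt => /predU1P[Fx|Fx]; last first.
  exact: continuous_powR_gt0.
have Fxr : F x `^ r = 0 by rewrite -Fx powR0// gt_eqF.
rewrite /prop_for /continuous_at Fxr.
apply/cvgr0Pnorm_le => e e0.
have : \forall y \near x, F y <= e `^ r^-1.
  by apply: cvgr_le cF _ _; rewrite -Fx powR_gt0.
apply: filterS => y Fye; rewrite ger0_norm ?powR_ge0//.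
have -> : e = (e `^ r^-1) `^ r by rewrite -powRrM mulVf ?gt_eqF// powRr1// ltW.
by rewrite ge0_ler_powR ?nnegrE ?powR_ge0// ltW.
Qed.

Lemma sqrt_powR (s : R) r : 0 <= s -> Num.sqrt s `^ r = s `^ (r / 2).
Proof. by move=> s0; rewrite -powR12_sqrt// -powRrM mulrC. Qed.

Lemma is_derive_sqrt_powR (V : normedModType R) (s : V -> R) r x v ds :
  (forall y, 0 <= s y) -> 0 < s x -> is_derive x v s ds ->
  is_derive x v (fun y => Num.sqrt (s y) `^ r)
    (r / 2 * Num.sqrt (s x) `^ (r - 2) * ds).
Proof.
move=> s0 sx dsx.
rewrite (_ : (fun _ => _) = (fun z => z `^ (r / 2)) \o s); last first.
  by apply/funext => y /=; rewrite sqrt_powR.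
rewrite sqrt_powR// (_ : (r - 2) / 2 = r / 2 - 1); last by field.
by apply: is_derive_comp1 => //; exact: is_derive1_powR.
Qed.

Lemma sqrt_sqrD_le (a b : R) : Num.sqrt (a ^+ 2 + b ^+ 2) <= `|a| + `|b|.
Proof.
rewrite -[leRHS]ger0_norm ?addr_ge0// -sqrtr_sqr ler_wsqrtr//.
rewrite sqrrD !real_normK ?num_real// lerD2r lerDl.
by rewrite mulrn_wge0// mulr_ge0.
Qed.

(** Write z = A + i B.  Where z vanishes its modulus may fail to be
differentiable, but |z(x + h v)|^p / |h| is at most the product of
|z(x + h v)|^(p-1), which tends to 0 because p > 1, and of (|A| + |B|) / |h|
at x + h v, which converges. *)
Lemma is_derive_mod_powR (V : normedModType R) (A B : V -> R) p x v dA dB :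
  1 < p -> is_derive x v A dA -> is_derive x v B dB ->
  is_derive x v (fun y => Num.sqrt (A y ^+ 2 + B y ^+ 2) `^ p)
    (p * Num.sqrt (A x ^+ 2 + B x ^+ 2) `^ (p - 2) * (A x * dA + B x * dB)).
Proof.
move=> p1 hA hB; set s := fun y => A y ^+ 2 + B y ^+ 2.
have s0 y : 0 <= s y by rewrite addr_ge0// sqr_ge0.
have := s0 x; rewrite le_eqVlt => /predU1P[sx|sx]; last first.
  have ds : is_derive x v s (2 * (A x * dA + B x * dB)).
    have := is_deriveD (is_deriveX 2 hA) (is_deriveX 2 hB).
    rewrite (_ : _ + _ = s); last by apply/funext => y.
    move=> h; apply: (is_derive_eq h).
    rewrite !mulr2n -![_ *: _]/(_ * _) /=; ring.
  apply: (is_derive_eq (is_derive_sqrt_powR p s0 sx ds)).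
  by rewrite -/(s x); field.
have [Ax Bx] : A x = 0 /\ B x = 0.
  move/esym/eqP : sx; rewrite paddr_eq0 ?sqr_ge0// !sqrf_eq0.
  by move=> /andP[/eqP -> /eqP ->].
rewrite Ax Bx !mul0r addr0 mulr0.
suff h : (fun h : R => h^-1 *:
    (((fun y => Num.sqrt (s y) `^ p) \o shift x) (h *: v) -
     Num.sqrt (s x) `^ p)) @ 0^' --> 0.
  by split; [apply/cvg_ex; exists 0|exact/cvg_lim].
rewrite -sx sqrtr0 powR0 ?gt_eqF ?(lt_trans _ p1)//.
pose m (h : R) := Num.sqrt (s (h *: v + x)).
have cline (C : V -> R) d : is_derive x v C d ->
    {for 0, continuous (fun h : R => C (h *: v + x))}.
  move=> /is_derive_line[dC _].
  exact/differentiable_continuous/derivable1_diffP.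
have quot (C : V -> R) d : C x = 0 -> is_derive x v C d ->
    `|h^-1 * C (h *: v + x)| @[h --> 0^'] --> `|d|.
  move=> Cx [dC <-]; apply: cvg_norm.
  have E : (fun h : R => h^-1 *: ((C \o shift x) (h *: v) - C x)) =
      (fun h => h^-1 * C (h *: v + x)).
    by apply/funext => h /=; rewrite Cx subr0.
  by move: dC; rewrite /derivable /derive E.
have cm : {for 0, continuous m}.
  apply: (@continuous_comp _ _ _ _ Num.sqrt); last exact: sqrt_continuous.
  have csq (C : V -> R) d : is_derive x v C d ->
      {for 0, continuous (fun h : R => C (h *: v + x) ^+ 2)}.
    move=> dC; apply: (@continuous_comp _ _ _ (fun h : R => C (h *: v + x))
      (fun z => z ^+ 2)); [exact: cline dC|exact: exprn_continuous].
  by apply: cvgD; [exact: csq hA|exact: csq hB].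
have cp1 : m h `^ (p - 1) @[h --> 0^'] --> 0.
  have m0 : m 0 `^ (p - 1) = 0.
    by rewrite /m scale0r add0r -sx sqrtr0 powR0// gt_eqF// subr_gt0.
  have p10 : 0 < p - 1 by rewrite subr_gt0.
  have /continuous_withinNx := continuous_powR p10 (fun h => sqrtr_ge0 _) cm.
  by rewrite m0.
apply/norm_cvg0P.
apply: (@squeeze_cvgr _ _ _ _ (fun=> 0)
  (fun h => m h `^ (p - 1) *
    (`|h^-1 * A (h *: v + x)| + `|h^-1 * B (h *: v + x)|))).
- near=> h; rewrite normr_ge0 /= subr0 -/(m h).
  rewrite normrZ (ger0_norm (powR_ge0 _ _)).
  rewrite -mulr_powRB1 ?sqrtr_ge0 ?(lt_trans _ p1)// mulrA mulrC.
  rewrite ler_wpM2l ?powR_ge0// !normrM -mulrDr ler_wpM2l//.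
  exact: sqrt_sqrD_le.
- exact: cvg_cst.
- have : (m h `^ (p - 1) *
      (`|h^-1 * A (h *: v + x)| + `|h^-1 * B (h *: v + x)|))
    @[h --> 0^'] --> 0 * (`|dA| + `|dB|).
    by apply: cvgM => //; apply: cvgD; exact: quot.
  by rewrite mul0r.
Unshelve. all: by end_near. Qed.

(** With a = sum u^2 and c = sum u v, the expansion of sum (a v - c u)^2 is
a (a sum v^2 - c^2). *)
Lemma cauchy_schwarz_sum m (u v : 'I_m -> R) :
  `|\sum_i u i * v i| <=
  Num.sqrt (\sum_i u i ^+ 2) * Num.sqrt (\sum_i v i ^+ 2).
Proof.
set a := \sum_i u i ^+ 2; set b := \sum_i v i ^+ 2; set c := \sum_i _.
have a0 : 0 <= a by apply: sumr_ge0 => i _; exact: sqr_ge0.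
have b0 : 0 <= b by apply: sumr_ge0 => i _; exact: sqr_ge0.
rewrite -sqrtrM// -sqrtr_sqr ler_wsqrtr//.
have [a_eq0|a_neq0] := eqVneq a 0.
  suff -> : c = 0 by rewrite expr0n/= mulr_ge0.
  rewrite /c big1// => i _.
  move/eqP : a_eq0; rewrite psumr_eq0 => [/allP/(_ i)|j _]; last exact: sqr_ge0.
  by rewrite mem_index_enum sqrf_eq0 => /(_ isT)/eqP ->; rewrite mul0r.
have : 0 <= \sum_i (a * v i - c * u i) ^+ 2.
  by apply: sumr_ge0 => i _; exact: sqr_ge0.
have -> : \sum_i (a * v i - c * u i) ^+ 2 = a * (a * b - c ^+ 2).
  rewrite (eq_bigr (fun i => a ^+ 2 * (v i ^+ 2) + (- (2 * a * c)) * (u i * v i)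
    + c ^+ 2 * (u i ^+ 2))); last by move=> i _; ring.
  by rewrite !big_split /= -!mulr_sumr -/a -/b -/c; ring.
by rewrite pmulr_rge0 ?lt_def ?a_neq0// subr_ge0.
Qed.

Lemma cauchy_schwarz2 (a b c d : R) : `|a * c + b * d| <=
  Num.sqrt (a ^+ 2 + b ^+ 2) * Num.sqrt (c ^+ 2 + d ^+ 2).
Proof.
have := @cauchy_schwarz_sum 2 (fun i => if i == ord0 then a else b)
  (fun i => if i == ord0 then c else d).
by rewrite !big_ord_recl !big_ord0 /= !addr0.
Qed.

Lemma norm_le_sqrt_sqrD (a b : R) : `|a| <= Num.sqrt (a ^+ 2 + b ^+ 2).
Proof. by rewrite -sqrtr_sqr ler_wsqrtr// lerDl sqr_ge0. Qed.

Lemma norm_le_sqrt_sqrDr (a b : R) : `|b| <= Num.sqrt (a ^+ 2 + b ^+ 2).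
Proof. by rewrite addrC norm_le_sqrt_sqrD. Qed.

Lemma sqrt_sqrD_eq0 (a b : R) :
  Num.sqrt (a ^+ 2 + b ^+ 2) = 0 -> a = 0 /\ b = 0.
Proof.
move=> h; have := norm_le_sqrt_sqrD a b; have := norm_le_sqrt_sqrDr a b.
by rewrite h !normr_le0 => /eqP -> /eqP ->.
Qed.

Lemma continuous_sqrt_sqrD (T : topologicalType) (A B : T -> R) x :
  {for x, continuous A} -> {for x, continuous B} ->
  {for x, continuous (fun y => Num.sqrt (A y ^+ 2 + B y ^+ 2))}.
Proof.
move=> cA cB; apply: (@continuous_comp _ _ _ (fun y => A y ^+ 2 + B y ^+ 2)
  (@Num.sqrt R)); last exact: sqrt_continuous.
by apply: cvgD; apply: (@continuous_comp _ _ _ _ (fun z : R => z ^+ 2)) => //;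
  exact: exprn_continuous.
Qed.

(** The factor |z|^(p-2) may blow up at the zeros of z = A + i B; it is
compensated by A dA + B dB, which is at most |z| (|dA| + |dB|). *)
Lemma continuous_derive_mod_powR (T : topologicalType)
    (A B dA dB : T -> R) p x :
  1 < p -> {for x, continuous A} -> {for x, continuous B} ->
  {for x, continuous dA} -> {for x, continuous dB} ->
  {for x, continuous (fun y => p * Num.sqrt (A y ^+ 2 + B y ^+ 2) `^ (p - 2) *
    (A y * dA y + B y * dB y))}.
Proof.
move=> p1 cA cB cdA cdB; pose m y := Num.sqrt (A y ^+ 2 + B y ^+ 2).
have p0 : 0 < p by rewrite (lt_trans _ p1).
have cm : {for x, continuous m} by exact: continuous_sqrt_sqrD.
have := sqrtr_ge0 (A x ^+ 2 + B x ^+ 2).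
rewrite le_eqVlt => /predU1P[/esym mx|mx]; last first.
  apply: cvgM; last by apply: cvgD; exact: cvgM.
  apply: cvgM; first exact: cvg_cst.
  exact: (@continuous_powR_gt0 _ m _ _ mx cm).
have [Ax Bx] := sqrt_sqrD_eq0 mx.
rewrite /prop_for /continuous_at Ax Bx !mul0r addr0 mulr0.
apply/norm_cvg0P.
apply: (@squeeze_cvgr _ _ _ _ (fun=> 0)
  (fun y => p * m y `^ (p - 1) * (`|dA y| + `|dB y|))).
- near=> y; rewrite normr_ge0 /= -/(m y) !normrM gtr0_norm// -!mulrA.
  rewrite ler_wpM2l ?(ltW p0)// ger0_norm ?powR_ge0//.
  have [my|my] := eqVneq (m y) 0.
    have [-> ->] := sqrt_sqrD_eq0 my.
    by rewrite !mul0r addr0 normr0 mulr0 mulr_ge0 ?powR_ge0// addr_ge0.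
  have -> : p - 1 = p - 2 + 1 by ring.
  rewrite (@powRD _ _ (p - 2) 1); last by rewrite my implybT.
  rewrite powRr1 ?sqrtr_ge0// -mulrA ler_wpM2l ?powR_ge0//.
  rewrite (le_trans (ler_normD _ _))// !normrM mulrDr lerD// ler_wpM2r//.
    exact: norm_le_sqrt_sqrD.
  exact: norm_le_sqrt_sqrDr.
- exact: cvg_cst.
- have : (p * m y `^ (p - 1) * (`|dA y| + `|dB y|)) @[y --> x] -->
      p * m x `^ (p - 1) * (`|dA x| + `|dB x|).
    apply: cvgM; last by apply: cvgD; exact: cvg_norm.
    apply: cvgM; first exact: cvg_cst.
    by apply: continuous_powR => // [|y]; [rewrite subr_gt0|exact: sqrtr_ge0].
  by rewrite /m mx powR0 ?gt_eqF ?subr_gt0// mulr0 mul0r.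
Unshelve. all: by end_near. Qed.

(** Young's inequality b t <= b^p / p + t^q / q for t = u^(p-1), with q the
conjugate exponent p / (p - 1). *)
Lemma young_powR (p u b : R) : 1 < p -> 0 <= u -> 0 <= b ->
  p * (u `^ (p - 1) * b) <= b `^ p + (p - 1) * u `^ p.
Proof.
move=> p_gt1 u0 b0; have p_gt0 : 0 < p by exact: lt_trans p_gt1.
have p10 : 0 < p - 1 by rewrite subr_gt0.
have := @conjugate_powR R b (u `^ (p - 1)) p (p / (p - 1)) b0 (powR_ge0 _ _)
  p_gt0 (divr_gt0 p_gt0 p10).
have p0 : p != 0 by rewrite gt_eqF.
have p1 : p - 1 != 0 by rewrite gt_eqF.
rewrite -powRrM (_ : (p - 1) * (p / (p - 1)) = p); last by field.
rewrite (_ : p^-1 + _ = 1); last by rewrite invf_div; field.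
move=> /(_ erefl); rewrite -(ler_pM2l p_gt0) => h.
rewrite (mulrC _ b); apply: (le_trans h).
by rewrite le_eqVlt invf_div; apply/orP; left; apply/eqP; field.
Qed.

End powers.

(** * Hardy inequality for divergence-free fields *)

Section hardy.
Context {R : realType} {n m : nat}.
Local Notation V := 'rV[R]_n.
(* The coordinates c i play the role of the first-stratum variables. *)
Variables (c : 'I_m -> 'I_n) (X : 'I_m -> V -> V).
Hypothesis X_c : forall k i x, X k x ord0 (c i) = (i == k)%:R.
Hypothesis X_div : forall k x j,
  is_derive x (delta_mx ord0 j : V) (fun y => X k y ord0 j) 0.
Hypothesis X_cont : forall k j, continuous (fun x => X k x ord0 j).
(* The real and imaginary parts of a C^1 function. *)
Variables (A B : V -> R).
Hypothesis A_diff : forall x, differentiable A x.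
Hypothesis B_diff : forall x, differentiable B x.
Hypothesis A_C1 : forall v, continuous ('D_v A).
Hypothesis B_C1 : forall v, continuous ('D_v B).
Variable p : R.
Hypothesis p_gt1 : 1 < p.

Let p_gt0 : 0 < p. Proof. exact: lt_trans p_gt1. Qed.

Definition rho (x : V) : R := Num.sqrt (\sum_i x ord0 (c i) ^+ 2).
Definition modAB (x : V) : R := Num.sqrt (A x ^+ 2 + B x ^+ 2).
Definition gradAB (x : V) : R :=
  Num.sqrt (\sum_k ('D_(X k x) A x ^+ 2 + 'D_(X k x) B x ^+ 2)).

Variable M : R.
Hypothesis A_supp : forall x, M < `|x| -> A x = 0.
Hypothesis B_supp : forall x, M < `|x| -> B x = 0.
Hypothesis AB_sing : forall x, rho x = 0 -> \forall y \near x, modAB y = 0.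

(** The derivatives along v of |A + i B|^p and, below, of the components
|A + i B|^p x'_k rho^(-p) of the flux. *)
Definition dmod (x v : V) : R :=
  p * modAB x `^ (p - 2) * (A x * 'D_v A x + B x * 'D_v B x).
Definition flux (k : 'I_m) (x : V) : R :=
  modAB x `^ p * (x ord0 (c k) * rho x `^ (- p)).
Definition dflux (k : 'I_m) (x v : V) : R :=
  dmod x v * (x ord0 (c k) * rho x `^ (- p)) +
  modAB x `^ p * (v ord0 (c k) * rho x `^ (- p) +
    x ord0 (c k) * (- p * rho x `^ (- p - 2) *
      \sum_i x ord0 (c i) * v ord0 (c i))).

Let A_derive x v : is_derive x v A ('D_v A x).
Proof. exact/derivableP/diff_derivable. Qed.
Let B_derive x v : is_derive x v B ('D_v B x).
Proof. exact/derivableP/diff_derivable. Qed.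

Lemma norm_coord_le_rho (x : V) i :
  `|x ord0 (c i)| <= rho x.
Proof.
rewrite -sqrtr_sqr ler_wsqrtr// (bigD1 i)//= lerDl.
by rewrite sumr_ge0// => j _; exact: sqr_ge0.
Qed.

Lemma is_derive_coord_id x v j :
  is_derive x v (fun y : V => y ord0 j) (v ord0 j).
Proof. exact: (is_derive_coord j (is_derive_id x v)). Qed.

Lemma modAB0 x : modAB x = 0 -> A x = 0 /\ B x = 0.
Proof. exact: sqrt_sqrD_eq0. Qed.

Lemma dmod0 x v : modAB x = 0 -> dmod x v = 0.
Proof. by move=> /modAB0[Ax Bx]; rewrite /dmod Ax Bx !mul0r addr0 mulr0. Qed.

Lemma dflux0 k x v : modAB x = 0 -> dflux k x v = 0.
Proof.
by move=> mx; rewrite /dflux dmod0// mx powR0 ?gt_eqF// !mul0r addr0.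
Qed.

Lemma rho_gt0 x : rho x != 0 -> 0 < rho x.
Proof. by move=> r0; rewrite lt_def r0 sqrtr_ge0. Qed.

(** Where rho = 0 the weight is singular, but the flux is locally zero there,
and so is the formula for its derivative. *)
Lemma is_derive_flux k x v : is_derive x v (flux k) (dflux k x v).
Proof.
have [r0|r0] := eqVneq (rho x) 0.
  have mx0 := nbhs_singleton (AB_sing r0).
  rewrite (dflux0 k v mx0).
  have f0 : \forall y \near x, cst 0 y = flux k y.
    apply: filterS (AB_sing r0) => y my.
    by rewrite /flux my powR0 ?gt_eqF// mul0r.
  exact: (near_eq_is_derive f0 (is_derive_cst _ _ _)).
have dP : is_derive x v (fun y => modAB y `^ p) (dmod x v).
  exact: is_derive_mod_powR.
have q0 (y : V) : 0 <= \sum_i y ord0 (c i) ^+ 2 :> R.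
  by apply: sumr_ge0 => i _; exact: sqr_ge0.
have qx : 0 < \sum_i x ord0 (c i) ^+ 2 by rewrite -sqrtr_gt0; exact: rho_gt0.
have dq : is_derive x v (fun y : V => \sum_i y ord0 (c i) ^+ 2)
    (\sum_i (v ord0 (c i) * x ord0 (c i) + x ord0 (c i) * v ord0 (c i))).
  apply: is_derive_bigsum => i.
  by apply: is_derive_mul; exact: is_derive_coord_id.
have dw := is_derive_sqrt_powR (- p) q0 qx dq.
apply: (is_derive_eq (is_derive_mul dP
  (is_derive_mul (is_derive_coord_id x v (c k)) dw))).
rewrite /dflux -/(rho x); congr (_ + _ * (_ + _ * _)).
rewrite -mulrA -[RHS]mulrA mulrCA [RHS]mulrCA; congr (_ * _).
by rewrite !mulr_sumr; apply: eq_bigr => i _; field.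
Qed.

Lemma continuous_modAB : continuous modAB.
Proof.
by move=> x; apply: continuous_sqrt_sqrD; exact: differentiable_continuous.
Qed.

Lemma continuous_rho : continuous rho.
Proof.
move=> x; apply: (@continuous_comp _ _ _ (fun y : V => \sum_i y ord0 (c i) ^+ 2)
  (@Num.sqrt R)); last exact: sqrt_continuous.
apply: (@continuous_bigsum R _ _ (fun i (y : V) => y ord0 (c i) ^+ 2)) => i.
apply: (@continuous_comp _ _ _ (fun y : V => y ord0 (c i))
  (fun z : R => z ^+ 2)).
  exact: coord_continuous.
exact: exprn_continuous.
Qed.

Lemma continuous_dflux k v : continuous (fun x => dflux k x v).
Proof.
move=> x; have [r0|r0] := eqVneq (rho x) 0.
  apply: (@near_cst_continuous _ _ 0).
  by apply: filterS (AB_sing r0) => y; exact: dflux0.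
have cw r : {for x, continuous (fun y => rho y `^ r)}.
  by apply: continuous_powR_gt0; [exact: rho_gt0|exact: continuous_rho].
have cc j : {for x, continuous (fun y : V => y ord0 j)}.
  exact: coord_continuous.
have cdm : {for x, continuous (fun y => dmod y v)}.
  apply: continuous_derive_mod_powR => //; try exact: differentiable_continuous.
    exact: A_C1.
  exact: B_C1.
have cP : {for x, continuous (fun y => modAB y `^ p)}.
  by apply: continuous_powR => // [y|];
    [exact: sqrtr_ge0|exact: continuous_modAB].
have cs : {for x, continuous (fun y : V => \sum_i y ord0 (c i) * v ord0 (c i))}.
  apply: (@continuous_bigsum R _ _
    (fun i (y : V) => y ord0 (c i) * v ord0 (c i))) => i.
  exact: continuousM (cc _) (@cst_continuous _ _ _ _).
have cf (a : R) : {for x, continuous (fun=> a)} by exact: cst_continuous.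
exact: (continuousD (continuousM cdm (continuousM (cc (c k)) (cw (- p))))
  (continuousM cP (continuousD (continuousM (cf (v ord0 (c k))) (cw (- p)))
    (continuousM (cc (c k)) (continuousM (continuousM (cf (- p)) (cw (- p - 2)))
      cs))))).
Qed.

Lemma dmod_linear x a u v : dmod x (a *: u + v) = a * dmod x u + dmod x v.
Proof. by rewrite /dmod !derive_linear//; ring. Qed.

Lemma dflux_linear k x a u v :
  dflux k x (a *: u + v) = a * dflux k x u + dflux k x v.
Proof.
rewrite /dflux dmod_linear.
have -> : \sum_i x ord0 (c i) * (a *: u + v) ord0 (c i) =
    a * (\sum_i x ord0 (c i) * u ord0 (c i)) +
    \sum_i x ord0 (c i) * v ord0 (c i).
  by rewrite mulr_sumr -big_split; apply: eq_bigr => i _ /=; rewrite !mxE; ring.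
by rewrite !mxE; ring.
Qed.

(** The horizontal divergence sum_k X_k (flux k). *)
Definition hdiv (x : V) : R := \sum_k dflux k x (X k x).

(** Because X_k x'_i = delta_ik, the derivative of rho^(-p) contributes
- p rho^(-p-2) sum_k x'_k^2 = - p rho^(-p), and that of the x'_k contributes
m rho^(-p). *)
Lemma hdivE x : rho x != 0 -> hdiv x = rho x `^ (- p) *
  ((m%:R - p) * modAB x `^ p + \sum_k x ord0 (c k) * dmod x (X k x)).
Proof.
move=> r0; rewrite /hdiv.
have E k : \sum_i x ord0 (c i) * X k x ord0 (c i) = x ord0 (c k).
  rewrite (bigD1 k)//= X_c eqxx mulr1 big1 ?addr0// => i ik.
  by rewrite X_c (negbTE ik) mulr0.
have rr : rho x `^ (- p - 2) * rho x ^+ 2 = rho x `^ (- p).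
  rewrite -powR_mulrn ?sqrtr_ge0// -powRD ?subrK//.
  by rewrite r0 implybT.
have r2 : \sum_k x ord0 (c k) ^+ 2 = rho x ^+ 2.
  by rewrite sqr_sqrtr// sumr_ge0// => i _; exact: sqr_ge0.
rewrite (eq_bigr (fun k => rho x `^ (- p) * (x ord0 (c k) * dmod x (X k x)) +
    (modAB x `^ p * rho x `^ (- p) -
     p * modAB x `^ p * rho x `^ (- p - 2) * x ord0 (c k) ^+ 2))); last first.
  by move=> k _; rewrite /dflux E X_c eqxx /=; ring.
rewrite !big_split /= -mulr_sumr sumr_const card_ord.
rewrite -[_ *+ m]mulr_natl sumrN -mulr_sumr r2 -[p * _ * _ * _]mulrA rr.
by ring.
Qed.

Lemma hdiv0 x : modAB x = 0 -> hdiv x = 0.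
Proof. by move=> mx; rewrite /hdiv big1// => k _; exact: dflux0. Qed.

(** The Euclidean components of sum_k flux_k X_k; as the X_k are
divergence-free, the divergence of this field is hdiv. *)
Definition hflux (j : 'I_n) (x : V) : R := \sum_k X k x ord0 j * flux k x.
Definition dhflux (j : 'I_n) (x : V) : R :=
  \sum_k X k x ord0 j * dflux k x (delta_mx ord0 j).

Lemma is_derive_hflux j x :
  is_derive x (delta_mx ord0 j : V) (hflux j) (dhflux j x).
Proof.
apply: is_derive_bigsum => k.
apply: (is_derive_eq (is_derive_mul (X_div k x j) (is_derive_flux k x _))).
by rewrite mul0r add0r.
Qed.

Lemma continuous_dhflux j : continuous (dhflux j).
Proof.
move=> x; apply: (@continuous_bigsum R _ _
  (fun k y => X k y ord0 j * dflux k y (delta_mx ord0 j))) => k.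
exact: (continuousM (@X_cont k j x) (@continuous_dflux k (delta_mx ord0 j) x)).
Qed.

Lemma modAB_supp x : M < `|x| -> modAB x = 0.
Proof.
by move=> Mx; rewrite /modAB A_supp// B_supp// expr0n addr0 sqrtr0.
Qed.

Lemma hflux_supp j x : M < `|x| -> hflux j x = 0.
Proof.
move=> Mx; rewrite /hflux big1// => k _.
by rewrite /flux modAB_supp// powR0 ?gt_eqF// mul0r mulr0.
Qed.

Lemma dhflux_supp j x : M < `|x| -> dhflux j x = 0.
Proof.
by move=> Mx; rewrite /dhflux big1// => k _; rewrite dflux0 ?mulr0// modAB_supp.
Qed.

Lemma hdiv_sum x : hdiv x = \sum_j dhflux j x.
Proof.
rewrite /hdiv /dhflux exchange_big /=; apply: eq_bigr => k _.
by apply: row_linear_sum => a u w; exact: dflux_linear.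
Qed.

Lemma integrable_hdiv : (lebesgue_rV n).-integrable setT (EFin \o hdiv).
Proof.
rewrite (_ : EFin \o hdiv = fun x => (\sum_j (dhflux j x)%:E)%E); last first.
  by apply/funext => x /=; rewrite hdiv_sum sumEFin.
apply: integrable_sum => // j _.
apply: continuous_supported_integrable; first exact: continuous_dhflux.
exact: dhflux_supp.
Qed.

Lemma integral_hdiv : (\int[lebesgue_rV n]_x (hdiv x)%:E = 0)%E.
Proof.
under eq_integral do rewrite hdiv_sum -sumEFin.
rewrite integral_sum//; last first.
  move=> j; apply: continuous_supported_integrable.
    exact: continuous_dhflux.
  exact: dhflux_supp.
rewrite big1// => j _; apply: (@integral_partial_derive _ _ j (hflux j) _ M).
- exact: continuous_dhflux.
- exact: hflux_supp.
- exact: is_derive_hflux.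
Qed.

Lemma field_derive_sum (f : V -> R) k x : differentiable f x ->
  'D_(X k x) f x = \sum_j X k x ord0 j * 'D_(delta_mx ord0 j) f x.
Proof.
by move=> df; apply: row_linear_sum => a u w; exact: derive_linear.
Qed.

Lemma continuous_field_derive (f : V -> R) k :
  (forall x, differentiable f x) -> (forall v, continuous ('D_v f)) ->
  continuous (fun x => 'D_(X k x) f x).
Proof.
move=> df cf; under eq_fun do rewrite field_derive_sum//.
move=> x; apply: (@continuous_bigsum R _ _
  (fun j y => X k y ord0 j * 'D_(delta_mx ord0 j) f y)) => j.
exact: (continuousM (@X_cont k j x) (@cf _ x)).
Qed.

Lemma continuous_gradAB : continuous gradAB.
Proof.
move=> x; apply: (@continuous_comp _ _ _ (fun y : V =>
  \sum_k ('D_(X k y) A y ^+ 2 + 'D_(X k y) B y ^+ 2)) (@Num.sqrt R)).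
  apply: (@continuous_bigsum R _ _
    (fun k (y : V) => 'D_(X k y) A y ^+ 2 + 'D_(X k y) B y ^+ 2)) => k.
  have csq (f : V -> R) : (forall x, differentiable f x) ->
      (forall v, continuous ('D_v f)) ->
      {for x, continuous (fun y => 'D_(X k y) f y ^+ 2)}.
    move=> df cf; apply: (@continuous_comp _ _ _ (fun y => 'D_(X k y) f y)
      (fun z : R => z ^+ 2)); last exact: exprn_continuous.
    exact: continuous_field_derive.
  exact: continuousD (csq A A_diff A_C1) (csq B B_diff B_C1).
exact: sqrt_continuous.
Qed.

Lemma gradAB_supp x : M < `|x| -> gradAB x = 0.
Proof.
move=> Mx; rewrite /gradAB big1 ?sqrtr0// => k _.
rewrite (is_derive_supported A_supp Mx (A_derive x (X k x))).
rewrite (is_derive_supported B_supp Mx (B_derive x (X k x))).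
by rewrite expr0n addr0.
Qed.

Lemma integrable_powR_supp (f : V -> R) :
  continuous f -> (forall x, 0 <= f x) ->
  (forall x, M < `|x| -> f x = 0) ->
  (lebesgue_rV n).-integrable setT (fun x => (f x `^ p)%:E).
Proof.
move=> cf f0 fM.
apply: (@continuous_supported_integrable R n (fun x => f x `^ p) M).
  by move=> x; apply: continuous_powR => //; exact: cf.
by move=> x Mx; rewrite fM// powR0// gt_eqF.
Qed.

(** Cauchy-Schwarz twice: over the real and imaginary parts, and over k. *)
Lemma norm_radial_derive_le (x : V) :
  `|\sum_k x ord0 (c k) * (A x * 'D_(X k x) A x + B x * 'D_(X k x) B x)| <=
  rho x * modAB x * gradAB x.
Proof.
rewrite (le_trans (cauchy_schwarz_sum _ _))// -mulrA ler_wpM2l ?sqrtr_ge0//.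
rewrite -sqrtrM ?addr_ge0 ?sqr_ge0// ler_wsqrtr// mulr_sumr ler_sum// => k _.
rewrite -(@ler_sqrt _ _ (_ * _)) ?mulr_ge0 ?addr_ge0 ?sqr_ge0//.
rewrite sqrtr_sqr sqrtrM ?addr_ge0 ?sqr_ge0//.
exact: cauchy_schwarz2.
Qed.

Variable Rad : R.
Hypothesis rho_le : forall x, modAB x != 0 -> rho x <= Rad.
Hypothesis Rad_gt0 : 0 < Rad.
Hypothesis m_neq_p : m%:R - p != 0.

Let d : R := m%:R - p.
Let K := `|d| / (Rad * p).
(* The sign makes the main term kappa * (m - p) positive. *)
Let kappa := Num.sg d * (`|d| / p) `^ (p - 1).

(** Let a = |A + i B|, b the length of the horizontal gradient, t = |d| / p
and al = a / rho.  The divergence is d al^p + p F with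
|F| <= al^(p-1) b, hence kappa * hdiv >= p (t al)^p - p (t al)^(p-1) b, and
young_powR for u = t al bounds the last product. *)
Lemma hardy_pointwise x :
  (K * modAB x) `^ p <= gradAB x `^ p + kappa * hdiv x.
Proof.
have [a0|a_neq0] := eqVneq (modAB x) 0.
  by rewrite a0 hdiv0// !mulr0 addr0 powR0 ?powR_ge0// gt_eqF.
have rho_neq0 : rho x != 0.
  by apply: contra_neq a_neq0 => /AB_sing/nbhs_singleton.
have r0 := rho_gt0 rho_neq0.
have a0 : 0 < modAB x by rewrite lt_def a_neq0 sqrtr_ge0.
have b0 : 0 <= gradAB x by exact: sqrtr_ge0.
set a := modAB x in a0 a_neq0 *; set b := gradAB x in b0 *.
pose t := `|d| / p; pose al := a / rho x.
have t0 : 0 < t by rewrite divr_gt0// normr_gt0.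
have al0 : 0 < al by rewrite divr_gt0.
have Kle : K * a <= t * al.
  have -> : K * a = t * (a / Rad).
    by rewrite /K /t; field; rewrite !gt_eqF.
  rewrite ler_wpM2l ?(ltW t0)// /al ler_wpM2l ?(ltW a0)//.
  by rewrite lef_pV2 ?posrE//; exact: rho_le.
apply: (@le_trans _ _ ((t * al) `^ p)).
  have K0 : 0 <= K by rewrite divr_ge0// mulr_ge0 ?ltW.
  apply: ge0_ler_powR => //; first exact: ltW.
    by rewrite nnegrE mulr_ge0// ltW.
  by rewrite nnegrE mulr_ge0// ltW.
pose W := al `^ (p - 1); pose C := t `^ (p - 1).
have young := young_powR p_gt1 (ltW (mulr_gt0 t0 al0)) b0.
have uE : (t * al) `^ p = t * al * (C * W).
  have tal0 : 0 <= t * al by rewrite mulr_ge0 ?ltW.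
  by rewrite -(mulr_powRB1 tal0 p_gt0) powRM ?ltW.
pose T := \sum_k x ord0 (c k) * (A x * 'D_(X k x) A x + B x * 'D_(X k x) B x).
pose F := rho x `^ (- p) * a `^ (p - 2) * T.
have WE : rho x `^ (- p) * a `^ (p - 2) * (rho x * a) = W.
  rewrite mulrACA -{2}(powRr1 (ltW r0)) -{2}(powRr1 (ltW a0)).
  rewrite -!powRD ?rho_neq0 ?a_neq0 ?implybT//.
  rewrite /W /al powRM ?invr_ge0 ?(ltW a0) ?(ltW r0)//.
  rewrite -(powR_inv1 (ltW r0)) -powRrM mulrC; congr (_ `^ _ * _ `^ _); ring.
have FW : `|F| <= W * b.
  rewrite /F normrM ger0_norm ?mulr_ge0 ?powR_ge0// -WE -mulrA ler_wpM2l//.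
    by rewrite mulr_ge0 ?powR_ge0.
  exact: norm_radial_derive_le.
have alW : al * W = rho x `^ (- p) * a `^ p.
  rewrite /W (mulr_powRB1 (ltW al0) p_gt0) /al powRM ?invr_ge0 ?ltW// mulrC.
  by rewrite -(powR_inv1 (ltW r0)) -powRrM mulN1r.
have hE : hdiv x = d * (al * W) + p * F.
  rewrite hdivE// alW -/d -/a /F.
  rewrite (_ : \sum_k _ = p * a `^ (p - 2) * T); first by ring.
  by rewrite /T mulr_sumr; apply: eq_bigr => k _; rewrite /dmod; ring.
have sF : - (C * (W * b)) <= C * (Num.sg d * F).
  rewrite -mulrN ler_wpM2l ?powR_ge0//.
  apply: le_trans (_ : - `|Num.sg d * F| <= _); last first.
    by rewrite lerNl ler_normr lexx orbT.
  by rewrite lerN2 normrM normr_sg m_neq_p mul1r.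
have sd : Num.sg d * d = p * t.
  by rewrite -normrEsg /t mulrC divfK// gt_eqF.
rewrite -/C in young.
rewrite hE /kappa -/t -/C.
rewrite (_ : Num.sg d * C * (d * (al * W) + p * F) =
  C * (Num.sg d * d) * (al * W) + p * (C * (Num.sg d * F))); last by ring.
rewrite sd uE.
rewrite uE powRM ?(ltW t0) ?(ltW al0)// -/C -/W in young.
have := ler_wpM2l (ltW p_gt0) sF; lra.
Qed.

(** The divergence disappears on integrating hardy_pointwise. *)
Lemma hardy_integral :
  (\int[lebesgue_rV n]_x ((K * modAB x) `^ p)%:E <=
   \int[lebesgue_rV n]_x (gradAB x `^ p)%:E)%E.
Proof.
have iP : (lebesgue_rV n).-integrable setT (fun x => ((K * modAB x) `^ p)%:E).
  apply: (@integrable_powR_supp (fun x => K * modAB x)).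
  - move=> x.
    exact: continuousM (@cst_continuous _ _ _ _) (@continuous_modAB x).
  - by move=> x; rewrite mulr_ge0 ?sqrtr_ge0// divr_ge0// mulr_ge0 ?ltW.
  - by move=> x Mx; rewrite modAB_supp// mulr0.
have iG : (lebesgue_rV n).-integrable setT (fun x => (gradAB x `^ p)%:E).
  apply: integrable_powR_supp; [exact: continuous_gradAB| |exact: gradAB_supp].
  by move=> x; exact: sqrtr_ge0.
have iH := integrableZl measurableT kappa integrable_hdiv.
rewrite -[leRHS]adde0 -[X in (_ + X)%E](mule0 kappa%:E) -integral_hdiv.
rewrite -integralZl//; last exact: integrable_hdiv.
rewrite -integralD//.
apply: le_integral => //; first exact: integrableD.
by move=> x _; rewrite lee_fin; exact: hardy_pointwise.
Qed.

End hardy.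

(** * The theorem on stratified groups *)

Lemma cabsE (R : realType) (z : R[i]) :
  cabs z = Num.sqrt (complex.Re z ^+ 2 + complex.Im z ^+ 2).
Proof. by case: z. Qed.

Lemma Lp_normE (R : realType) n (Omega : set 'rV[R]_n) p (g : 'rV[R]_n -> R) :
  (forall x, 0 <= g x) -> (forall x, ~ Omega x -> g x = 0) ->
  Lp_norm Omega p g = ((\int[lebesgue_rV n]_x (g x `^ p)%:E) `^ p^-1)%E.
Proof.
move=> g0 gO; rewrite /Lp_norm unlock; congr (_ `^ _)%E.
apply: eq_integral => x _.
have -> : ((EFin \o g) \_ Omega) x = (g x)%:E.
  rewrite patchE; case: ifPn => //; rewrite notin_setE => /gO ->.
  by [].
by rewrite /= ger0_norm.
Qed.

Lemma near_closureC (T : topologicalType) (S : set T) x :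
  ~ closure S x -> \forall y \near x, ~ S y.
Proof.
move=> nSx.
have : open_nbhs x (~` closure S).
  by split=> //; exact/closed_openC/closed_closure.
move=> /open_nbhs_nbhs; apply: filterS => y; apply: contra_not.
exact: subset_closure.
Qed.

(** Comparison of integrals of p-th powers, read on the norms. *)
Lemma scale_poweR_le (R : realType) (K p : R) (a b : \bar R) :
  0 < p -> 0 <= K -> (0 <= a)%E -> (0 <= b)%E ->
  ((K `^ p)%:E * a <= b)%E -> (K%:E * a `^ p^-1 <= b `^ p^-1)%E.
Proof.
move=> p0 K0 a0 b0 Kab.
have -> : K%:E = ((K `^ p)%:E `^ p^-1)%E.
  by rewrite poweR_EFin -powRrM divff ?gt_eqF// powRr1.
rewrite -poweRM// ?lee_fin ?powR_ge0//.
apply: gt0_ler_poweR => //; first by rewrite invr_ge0 ltW.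
  by rewrite in_itv/= leey andbT mule_ge0// lee_fin powR_ge0.
by rewrite in_itv/= leey andbT.
Qed.

Theorem mainTheorem9 (R : realType) (r : nat) (N : 'I_r.+1 -> nat)
    (G : stratifiedGroup R N) (Omega : set 'rV[R]_(\sum_i N i))
    (Omega_domain : domain Omega) (Omega_bounded : bounded_set Omega)
    (p : R) (p_gt1 : 1 < p) (f : 'rV[R]_(\sum_i N i) -> R[i])
    (f_test :
       test_function (Omega `\` [set x | first_stratum x = 0]) f) :
  let radius := sup [set euclidean_norm (first_stratum x) | x in Omega] in
  ((`|(N ord0)%:R - p| / (radius * p))%:E *
     Lp_norm Omega p (fun x => cabs (f x))
   <= Lp_norm Omega p (fun x => hermitian_norm (horizontal_gradient G f x)))%E.
Proof.
cbv zeta; set radius := sup _; set K := `|_| / _.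
have p_gt0 : 0 < p by exact: lt_trans p_gt1.
(* K <= 0 covers p = N and the degenerate radius 0, where 0^-1 = 0. *)
have [K_le0|K_gt0] := leP K 0.
  apply: (@le_trans _ _ 0%E); last exact: Lnorm_ge0.
  by rewrite mule_le0_ge0 ?lee_fin//; exact: Lnorm_ge0.
pose c (k : 'I_(N ord0)) : 'I_(\sum_i N i) := tagnat.Rank ord0 k.
pose X := sg_field G.
pose A := @complex.Re R \o f; pose B := @complex.Im R \o f.
have rhoE x : euclidean_norm (first_stratum x) = rho c x.
  by congr Num.sqrt; apply: eq_bigr => i _; rewrite mxE.
have modE x : cabs (f x) = modAB A B x by rewrite cabsE.
have gradE x : hermitian_norm (horizontal_gradient G f x) = gradAB X A B x.
  congr Num.sqrt; apply: eq_bigr => k _; rewrite cabsE sqr_sqrtr//.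
  by rewrite addr_ge0// sqr_ge0.
have [A_smooth B_smooth Scompact SOmega] := f_test.
set S := closure _ in Scompact SOmega.
have [A_diff A_C1] := A_smooth 1%N; have [B_diff B_C1] := B_smooth 1%N.
have nS x : ~ S x -> f x = 0.
  by apply: contra_notP => fx; apply: subset_closure => /=; apply/eqP.
have near0 x : ~ S x -> \forall y \near x, f y = 0.
  by move=> /near_closureC; apply: filterS => y /= /negP; rewrite negbK => /eqP.
have mod0 x : f x = 0 -> modAB A B x = 0.
  by move=> fx; rewrite -modE fx cabsE /= expr0n addr0 sqrtr0.
have grad0 x : ~ S x -> gradAB X A B x = 0.
  move=> /near0 f0; rewrite /gradAB big1 ?sqrtr0// => k _.
  rewrite (@near_eq_derive _ _ _ A (cst 0)) ?(@near_eq_derive _ _ _ B (cst 0)).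
  - by rewrite !derive_cst expr0n addr0.
  - by apply: filterS f0 => y fy; rewrite /B /= fy.
  - by apply: filterS f0 => y fy; rewrite /A /= fy.
have SO x : ~ Omega x -> ~ S x by apply: contra_not => /SOmega[].
rewrite !Lp_normE; last 4 first.
- by move=> x; exact: sqrtr_ge0.
- by move=> x /SO /grad0; rewrite -gradE.
- by move=> x; rewrite modE; exact: sqrtr_ge0.
- by move=> x /SO /nS /mod0; rewrite -modE.
have [M0 [_ M0P]] := compact_bounded Scompact.
pose M := M0 + 1.
have f_supp x : M < `|x| -> f x = 0.
  move=> Mx; apply: nS => /(M0P M).
  by rewrite /M ltrDl ltr01 => /(_ erefl)/(lt_le_trans Mx); rewrite ltxx.
have sing x : rho c x = 0 -> \forall y \near x, modAB A B y = 0.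
  move=> rx; have : ~ S x.
    move=> /SOmega[_]; apply; apply/rowP => i; rewrite !mxE.
    by apply/eqP; rewrite -normr_le0 -rx; exact: norm_coord_le_rho.
  by move=> /near0; apply: filterS => y /mod0.
have Oub : has_ubound [set euclidean_norm (first_stratum x) | x in Omega].
  have [B0 [_ /(_ (B0 + 1))B0P]] := Omega_bounded.
  exists (Num.sqrt (\sum_(i < N ord0) (B0 + 1) ^+ 2)) => _ [x Ox <-].
  rewrite rhoE ler_wsqrtr// ler_sum// => i _.
  have xB : `|x ord0 (c i)| <= B0 + 1.
    by apply: (le_trans (norm_coord_le _ _)); apply: B0P => //; rewrite ltrDl.
  by rewrite -real_normK ?num_real// lerXn2r ?nnegrE// (le_trans _ xB).
have rho_le x : modAB A B x != 0 -> rho c x <= radius.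
  move=> mx; rewrite -rhoE; apply: ub_le_sup => //; exists x => //.
  by apply: contra_neqP mx => /SO/nS/mod0.
have radius_gt0 : 0 < radius.
  rewrite lt_neqAle; apply/andP; split.
    apply: contraTneq K_gt0 => /esym r0.
    by rewrite /K r0 mul0r invr0 mulr0 ltxx.
  have [_ _ [x Ox]] := Omega_domain.
  apply: (@le_trans _ _ (euclidean_norm (first_stratum x))).
    exact: sqrtr_ge0.
  by apply: ub_le_sup => //; exists x.
have N_neq_p : (N ord0)%:R - p != 0.
  by apply: contraTneq K_gt0 => Np; rewrite /K Np normr0 mul0r ltxx.
have X_c k i x : X k x ord0 (c i) = (i == k)%:R.
  rewrite /X sg_field_first_stratum; last by rewrite /stratum tagnat.Rank1K.
  by rewrite mxE eqxx /= (inj_eq (@tagnat.rank_inj _ _)) eq_Tagged.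
have A_supp x : M < `|x| -> A x = 0 by move=> /f_supp fx; rewrite /A /= fx.
have B_supp x : M < `|x| -> B x = 0 by move=> /f_supp fx; rewrite /B /= fx.
have := hardy_integral X_c (@sg_field_div0 _ _ _ G)
  (@sg_field_coord_continuous _ _ _ G) A_diff B_diff A_C1 B_C1 p_gt1
  A_supp B_supp sing rho_le radius_gt0 N_neq_p.
rewrite -/K => hardy.
under eq_integral do rewrite modE.
under [in leRHS]eq_integral do rewrite gradE.
have int_ge0 (g : 'rV[R]_(\sum_i N i) -> R) :
    (0 <= \int[lebesgue_rV (\sum_i N i)]_x (g x `^ p)%:E)%E.
  by apply: integral_ge0 => x _; rewrite lee_fin powR_ge0.
apply: (scale_poweR_le p_gt0 (ltW K_gt0) (int_ge0 _) (int_ge0 _)).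
apply: le_trans hardy.
rewrite -ge0_integralZl_EFin; first last.
- exact: powR_ge0.
- apply/measurable_EFinP; apply: continuous_measurable_rV => x.
  apply: (continuous_powR p_gt0); first by move=> y; exact: sqrtr_ge0.
  exact: continuous_modAB.
- by move=> x _; rewrite lee_fin powR_ge0.
- exact: measurableT.
under [leRHS]eq_integral do rewrite powRM ?(ltW K_gt0) ?sqrtr_ge0//.
exact: lexx.
Qed.
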